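(* For all positive integers $s,t$, the one-directed complete bipartite graph $\vec K_{s,t}$ is not Eulerian-avoidable. More precisely, if $s,t\ge 2$, then for every integer $r\ge t$ there is a (nonempty) Eulerian oriented graph with minimum out-degree exactly $r$ such that every nonempty subdigraph of it of minimum out-degree at least $t$ contains $\vec K_{s,t}$.
   Context: All digraphs are finite and loopless, with no parallel arcs; digons (pairs of oppositely directed arcs between two vertices) are allowed. An oriented graph is a digraph with no digon. A digraph is Eulerian if every vertex has equal in-degree and out-degree (no connectivity is required). For positive integers $s,t$, $\vec K_{s,t}$ denotes the orientation of the complete bipartite graph $K_{s,t}$ in which every arc goes from the part of size $s$ to the part of size $t$; these are the one-directed complete bipartite graphs (with nonempty parts). A digraph contains $F$ if it has a (not necessarily induced) subdigraph isomorphic to $F$; otherwise it is $F$-free. A digraph $F$ is Eulerian-avoidable if, for every positive integer $k$, there exists an integer $d$ such that every (nonempty) Eulerian digraph of minimum out-degree at least $d$ contains a (nonempty) $F$-free subdigraph (not required to be Eulerian) of minimum out-degree at least $k$. *)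

(* Defs.v *)
From HB Require Import structures.
From mathcomp Require Import all_boot.

Set Implicit Arguments.
Unset Strict Implicit.
Unset Printing Implicit Defensive.

Record digraph := Digraph {
  vertex :> finType;
  arc : rel vertex;
  arc_irrefl : irreflexive arc
}.

Definition nonempty (D : digraph) : Prop := 0 < #|D|.

Definition outdeg (D : digraph) (v : D) : nat := #|[set w : D | arc v w]|.
Definition indeg (D : digraph) (v : D) : nat := #|[set u : D | arc u v]|.

(* Every out-degree is smaller than #|D|, so the default value #|D| plays no
   role when D is nonempty (see leq_min_outdeg and min_outdeg_attained). The
   value 0 for the empty digraph is a junk value. *)
Definition min_outdeg (D : digraph) : nat :=
  \big[minn/#|D|]_(v : D) outdeg v.

Definition eulerian (D : digraph) : Prop := forall v : D, indeg v = outdeg v.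

Definition oriented (D : digraph) : Prop :=
  forall u v : D, arc u v -> ~~ arc v u.

Definition isomorphic (D E : digraph) : Prop :=
  exists2 f : D -> E, bijective f & forall u v : D, arc (f u) (f v) = arc u v.

(* A subdigraph is given by a set of vertices together with an arbitrary set
   of arcs of D between them; it need be neither induced nor spanning. *)
Record subdigraph (D : digraph) := Subdigraph {
  subvertex : {set D};
  subarc : rel D;
  subarcP : forall u v : D,
    subarc u v -> [/\ u \in subvertex, v \in subvertex & arc u v]
}.

Lemma subarc_irrefl (D : digraph) (H : subdigraph D) :
  irreflexive (fun u v : {x : D | x \in subvertex H} =>
                 subarc H (val u) (val v)).
Proof.
move=> u; apply/negP => /subarcP[_ _].
by rewrite arc_irrefl.
Qed.

Definition digraph_of_subdigraph (D : digraph) (H : subdigraph D) : digraph :=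
  @Digraph {x : D | x \in subvertex H} _ (@subarc_irrefl D H).

Coercion digraph_of_subdigraph : subdigraph >-> digraph.

Definition contains (D F : digraph) : Prop :=
  exists H : subdigraph D, isomorphic H F.

Definition free (F D : digraph) : Prop := ~ contains D F.

Definition bip_arc (s t : nat) (u v : 'I_s + 'I_t) : bool :=
  match u, v with inl _, inr _ => true | _, _ => false end.

Lemma bip_arc_irrefl (s t : nat) : irreflexive (@bip_arc s t).
Proof. by case. Qed.

(* The one-directed complete bipartite graph, all arcs from the part of size s
   to the part of size t. *)
Definition dirK (s t : nat) : digraph :=
  @Digraph ('I_s + 'I_t)%type _ (@bip_arc_irrefl s t).

(* Minimum out-degrees are natural numbers, so letting d range over nat rather
   than over all integers makes no difference. *)
Definition eulerian_avoidable (F : digraph) : Prop :=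
  forall k : nat, 0 < k -> exists d : nat, forall D : digraph,
    nonempty D -> eulerian D -> d <= min_outdeg D ->
    exists H : subdigraph D, [/\ nonempty H, free F H & k <= min_outdeg H].

Lemma outdeg_lt_card (D : digraph) (v : D) : outdeg v < #|D|.
Proof.
rewrite -cardsT; apply: proper_card; apply/properP; split; first exact: subsetT.
by exists v; rewrite ?inE // arc_irrefl.
Qed.

Lemma leq_min_outdeg (D : digraph) (k : nat) : nonempty D ->
  (k <= min_outdeg D) <-> (forall v : D, k <= outdeg v).
Proof.
move=> D0; split=> [kD v|kD].
  apply: leq_trans kD _; rewrite /min_outdeg.
  elim: (index_enum D) (mem_index_enum v) => //= w r IHr.
  rewrite inE big_cons geq_min => /predU1P[->|/IHr ->].
    by rewrite leqnn.
  by rewrite orbT.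
case/card_gt0P: D0 => v _.
have kD0 : k <= #|D| by apply: leq_trans (kD v) (ltnW (outdeg_lt_card v)).
by apply: (big_ind (leq k)) => // x y kx ky; rewrite leq_min kx.
Qed.

Lemma min_outdeg_attained (D : digraph) : nonempty D ->
  exists v : D, outdeg v = min_outdeg D.
Proof.
move=> D0; case: (pickP (fun v : D => outdeg v == min_outdeg D)) => [v /eqP|nD].
  by exists v.
have := ltnn (min_outdeg D); rewrite (_ : _ < _ = true) //.
apply/leq_min_outdeg => // v; rewrite ltn_neqAle eq_sym nD /=.
by move: v; apply/leq_min_outdeg.
Qed.

Lemma containsP (D F : digraph) :
  contains D F <->
  exists2 f : F -> D, injective f & forall u v : F, arc u v -> arc (f u) (f v).
Proof.
split=> [[H [f [g fK gK] fE]]|[f f_inj fE]].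
  exists (fun x => val (g x)) => [x y /val_inj/(can_inj gK)//|x y].
  by rewrite -{1}(gK x) -{1}(gK y) fE /= => /subarcP[].
pose S := [set f x | x : F].
pose A u v := [exists x, exists y, [&& u == f x, v == f y & arc x y]].
have AP u v : A u v -> [/\ u \in S, v \in S & arc u v].
  case/existsP=> x /existsP[y /and3P[/eqP-> /eqP-> xy]].
  by rewrite !imset_f // fE.
have fS x : f x \in S by rewrite imset_f.
exists (Subdigraph AP).
pose h (x : F) : Subdigraph AP := Sub (f x) (fS x).
have h_inj : injective h by move=> x y /(congr1 val)/f_inj.
have h_surj (u : Subdigraph AP) : exists x, h x == u.
  case: u => u uS; case/imsetP: (uS) => x _ ux.
  by exists x; apply/eqP/val_inj; rewrite /= ux.
pose g u := xchoose (h_surj u).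
have gK : cancel g h by move=> u; apply/eqP/(xchooseP (h_surj u)).
have hK : cancel h g by move=> x; apply: h_inj; rewrite gK.
exists g => [|u v]; first by exists h.
rewrite -[in RHS](gK u) -[in RHS](gK v) /=.
apply/idP/existsP => [uv|[x /existsP[y /and3P[/eqP/f_inj-> /eqP/f_inj-> //]]]].
by exists (g u); apply/existsP; exists (g v); rewrite !eqxx.
Qed.

(* Main.v *)
Require Import Defs.
From HB Require Import structures.
From mathcomp Require Import all_boot.

Set Implicit Arguments.
Unset Strict Implicit.
Unset Printing Implicit Defensive.

(* The name also denotes the arcs of cyclic sequences. *)
Local Notation arc := Defs.arc.

(** The digraph is a butterfly network closed up through a small set of hubs.
    It consists of [m + 1] levels, each a copy of the words of length [m] over
    ['I_r], and of [r] further vertices, the hubs.  A word on level [i] sends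
    arcs to the [r] words on level [i + 1] that agree with it off the letter
    [i]; every word on level [m] dominates all hubs, and every hub dominates all
    words on level [0].  Words have in- and out-degree [r], hubs [r ^ m], so the
    digraph is Eulerian with minimum out-degree [r].

    Let [H] be a subdigraph of minimum out-degree at least [t >= 2].  Following
    arcs of [H] leads to a word [f] on level [0] ([word_level0_reached]).  On the
    way from [f] to level [m] each letter is rewritten only once, so the
    words met form a tree: two distinct descendants of [f] on the same level
    before [m] have no common out-neighbour ([cone_injective]).  Hence [H]
    contains at least [t ^ m] words on level [m] ([cone_growth]), and
    [t ^ m > m] as [t >= 2].  For [m = s * 2 ^ r] this exceeds [s] times the
    number of sets of hubs, so [s] of these words have in [H] the same
    out-neighbourhood, which has at least [t] elements
    ([common_outneighbourhood]).  This is a one-directed complete bipartite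
    graph.

    Non-avoidability for all [s, t >= 1] follows, since a digraph that contains
    the graph for [(s, maxn t 2)] contains the one for [(s, t)]. *)

(** * One-directed complete bipartite subdigraphs *)

Lemma contains_dirK (G : digraph) (s t : nat) (P Q : {set G}) :
  s <= #|P| -> t <= #|Q| -> {in P & Q, forall x y, arc x y} ->
  contains G (dirK s t).
Proof.
move=> sP tQ PQ; apply/containsP.
pose h (u : dirK s t) : G :=
  match u with
  | inl i => enum_val (widen_ord sP i)
  | inr j => enum_val (widen_ord tQ j)
  end.
have hPQ i j : arc (h (inl i)) (h (inr j)) by apply: PQ; apply: enum_valP.
exists h; last by case=> [i|i] [j|j].
case=> [i|i] [j|j].
- by move=> /enum_val_inj/(congr1 val)/= ij; congr inl; apply: val_inj.
- by move=> ij; have := hPQ i j; rewrite ij arc_irrefl.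
- by move=> ij; have := hPQ j i; rewrite ij arc_irrefl.
- by move=> /enum_val_inj/(congr1 val)/= ij; congr inr; apply: val_inj.
Qed.

Lemma contains_dirK_monotone (G : digraph) (s t t' : nat) : t <= t' ->
  contains G (dirK s t') -> contains G (dirK s t).
Proof.
move=> tt' /containsP[h h_inj h_arc]; apply/containsP.
pose w (u : dirK s t) : dirK s t' :=
  match u with inl i => inl i | inr j => inr (widen_ord tt' j) end.
exists (h \o w); last by case=> [i|i] [j|j] // _; apply: h_arc.
apply: inj_comp h_inj _; case=> [i|i] [j|j] //= [] ij.
  by rewrite ij.
by congr inr; apply: val_inj.
Qed.

(** Sort the vertices of [X] by their out-neighbourhood, a subset of [A]: some
    class has at least [s] elements, and these dominate a common set. *)
Lemma common_outneighbourhood (G : digraph) (s t : nat) (X A : {set G}) :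
  (forall x : G, t <= outdeg x) ->
  (forall x y : G, x \in X -> arc x y -> y \in A) ->
  s * 2 ^ #|A| < #|X| -> contains G (dirK s t).
Proof.
move=> tG XA big; pose N (x : G) := [set y | arc x y].
pose K B := [set x in X | N x == B].
have [B sB|small] := pickP (fun B => s < #|K B|).
  have /set0Pn[x] : K B != set0 by rewrite -card_gt0; apply: leq_trans sB.
  rewrite inE => /andP[_ /eqP NxB].
  apply: (@contains_dirK _ _ _ (K B) B); first exact: ltnW.
    by rewrite -NxB; apply: tG.
  by move=> u v; rewrite inE => /andP[_ /eqP<-]; rewrite inE.
move: big; rewrite ltnNge => /negP[].
rewrite -card_powerset mulnC -sum_nat_const.
rewrite -sum1_card (partition_big N (mem (powerset A))) /=; last first.
  by move=> x xX; rewrite powersetE; apply/subsetP=> y; rewrite inE; apply: XA.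
apply: leq_sum => B _; have /negbT := small B; rewrite -leqNgt.
apply: leq_trans; rewrite -sum1_card; apply: eq_leq.
by apply: eq_bigl => x; rewrite inE.
Qed.

(** Counting the arcs that leave [X]: at least [t] per vertex of [X], at most
    one per vertex of [Y]. *)
Lemma injective_expansion (G : digraph) (t : nat) (X Y : {set G}) :
  (forall x : G, t <= outdeg x) ->
  (forall x y : G, x \in X -> arc x y -> y \in Y) ->
  (forall x x' y : G, x \in X -> x' \in X -> arc x y -> arc x' y -> x = x') ->
  t * #|X| <= #|Y|.
Proof.
move=> tG XY X_inj; rewrite mulnC -sum_nat_const.
apply: (@leq_trans (\sum_(x in X) \sum_(y in Y | arc x y) 1)).
  apply: leq_sum => x xX; apply: leq_trans (tG x) _; rewrite /outdeg -sum1_card.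
  apply: eq_leq; apply: eq_bigl => y; rewrite inE.
  by case xy: (arc x y); rewrite ?andbF // (XY x y).
rewrite (exchange_big_dep (mem Y)) /=; last by move=> x y _ /andP[].
rewrite -[#|Y|]sum1_card; apply: leq_sum => y yY; rewrite sum1_card.
apply/card_le1_eqP => x x'; rewrite [x \in _]unfold_in [x' \in _]unfold_in.
move=> /and3P[xX _ xy] /and3P[x'X _ x'y].
exact: (X_inj _ _ _ x'X xX x'y xy).
Qed.

(** * The closed butterfly network *)

Section Butterfly.

Variables r m : nat.

Definition word := {ffun 'I_m -> 'I_r}.

Definition eq_off (i : nat) (f g : word) : bool :=
  [forall k : 'I_m, (val k != i) ==> (f k == g k)].

Definition butterfly_arc (u v : 'I_r + 'I_m.+1 * word) : bool :=
  match u, v with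
  | inl _, inl _ => false
  | inl _, inr (i, _) => i == ord0
  | inr (i, _), inl _ => i == ord_max
  | inr (i, f), inr (j, g) => (val j == i.+1) && eq_off i f g
  end.

Lemma butterfly_arc_irrefl : irreflexive butterfly_arc.
Proof. by case=> [//|[i f]] /=; rewrite ltn_eqF. Qed.

Definition butterfly : digraph :=
  @Digraph ('I_r + 'I_m.+1 * word)%type _ butterfly_arc_irrefl.

Lemma eq_offP (i : nat) (f g : word) :
  reflect (forall k : 'I_m, val k != i -> f k = g k) (eq_off i f g).
Proof.
apply: (iffP forallP) => fg k; first by move/(implyP (fg k))/eqP.
by apply/implyP=> /fg->.
Qed.

Lemma eq_off_sym (i : nat) : symmetric (eq_off i).
Proof. by move=> f g; apply: eq_forallb => k /=; rewrite [f k == _]eq_sym. Qed.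

Lemma card_eq_off (i : 'I_m) (f : word) : #|[set g | eq_off i f g]| = r.
Proof.
pose upd x : word := [ffun k => if k == i then x else f k].
have upd_inj : injective upd by move=> x y /ffunP/(_ i); rewrite !ffunE eqxx.
rewrite -[RHS](card_ord r) -cardsT -(card_imset _ upd_inj).
apply: eq_card => g; rewrite inE; apply/eq_offP/imsetP => [fg|[x _ ->] k ki].
  exists (g i) => //; apply/ffunP => k; rewrite ffunE.
  by case: eqVneq => [->//|ki]; rewrite fg.
by rewrite ffunE ifN.
Qed.

Let inl_inj : injective (inl : 'I_r -> butterfly).
Proof. by move=> a b []. Qed.

Let inr_inj (i : 'I_m.+1) : injective (fun g : word => inr (i, g) : butterfly).
Proof. by move=> g h []. Qed.

Lemma outdeg_hub (a : 'I_r) : outdeg (inl a : butterfly) = r ^ m.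
Proof.
rewrite -[r in RHS]card_ord -[m in RHS]card_ord -card_ffun -cardsT.
rewrite -(card_imset _ (@inr_inj ord0)).
apply: eq_card => -[b|[i g]]; rewrite inE /=.
  by apply/esym/imsetP => -[].
by apply/eqP/imsetP => [->|[h _ []//]]; exists g.
Qed.

Lemma indeg_hub (a : 'I_r) : indeg (inl a : butterfly) = r ^ m.
Proof.
rewrite -[r in RHS]card_ord -[m in RHS]card_ord -card_ffun -cardsT.
rewrite -(card_imset _ (@inr_inj ord_max)).
apply: eq_card => -[b|[i g]]; rewrite inE /=.
  by apply/esym/imsetP => -[].
by apply/eqP/imsetP => [->|[h _ []//]]; exists g.
Qed.

Lemma outdeg_word (i : 'I_m.+1) (f : word) : outdeg (inr (i, f) : butterfly) = r.
Proof.
have [im|mi] := ltnP i m.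
  have im1 : i.+1 < m.+1 by [].
  rewrite -[RHS](card_eq_off (Ordinal im) f).
  rewrite -(card_imset _ (@inr_inj (Ordinal im1))).
  apply: eq_card => -[b|[j g]]; rewrite inE /=.
    rewrite -val_eqE /= ltn_eqF //.
    by apply/esym/imsetP => -[].
  apply/andP/imsetP => [[/eqP ji fg]|[h]].
    by exists g; rewrite ?inE //; congr (inr (_, _)); apply: val_inj.
  by rewrite inE => fh [-> ->].
have {mi}-> : i = ord_max.
  by apply: val_inj; apply/eqP; rewrite eqn_leq -ltnS ltn_ord.
rewrite -[RHS]card_ord -cardsT -(card_imset _ inl_inj).
apply: eq_card => -[b|[j g]]; rewrite inE /= ?eqxx.
  by apply/esym/imsetP; exists b.
by rewrite ltn_eqF ?ltn_ord //=; apply/esym/imsetP => -[].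
Qed.

Lemma indeg_word (i : 'I_m.+1) (f : word) : indeg (inr (i, f) : butterfly) = r.
Proof.
case: (posnP i) => [i0|i_gt0].
  rewrite -[RHS]card_ord -cardsT -(card_imset _ inl_inj).
  apply: eq_card => -[b|[j g]]; rewrite inE /=.
    by rewrite -val_eqE /= i0; apply/esym/imsetP; exists b.
  by rewrite i0 /=; apply/esym/imsetP => -[].
have im : i.-1 < m by rewrite -ltnS prednK.
have im1 : i.-1 < m.+1 by apply: ltnW.
rewrite -[RHS](card_eq_off (Ordinal im) f).
rewrite -(card_imset _ (@inr_inj (Ordinal im1))).
apply: eq_card => -[b|[j g]]; rewrite inE /=.
  by rewrite -val_eqE /= gtn_eqF //; apply/esym/imsetP => -[].
apply/andP/imsetP => [[/eqP ij gf]|[h]].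
  exists g; first by rewrite inE /= eq_off_sym ij.
  by congr (inr (_, _)); apply: val_inj; rewrite /= ij.
by rewrite inE eq_off_sym => fh [-> ->] /=; rewrite prednK.
Qed.

Lemma eulerian_butterfly : eulerian butterfly.
Proof.
by case=> [a|[i f]]; rewrite ?outdeg_hub ?indeg_hub ?outdeg_word ?indeg_word.
Qed.

Lemma oriented_butterfly : 0 < m -> oriented butterfly.
Proof.
move=> m_gt0 [a|[i f]] [b|[j g]] //=.
- by move/eqP->; rewrite -val_eqE /= ltn_eqF.
- by move/eqP->; rewrite -val_eqE /= gtn_eqF.
- by case/andP=> /eqP-> _; rewrite ltn_eqF.
Qed.

Lemma nonempty_butterfly : 0 < r -> nonempty butterfly.
Proof. by move=> r_gt0; apply/card_gt0P; exists (inl (Ordinal r_gt0)). Qed.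

Lemma min_outdeg_butterfly : 0 < r -> 0 < m -> min_outdeg butterfly = r.
Proof.
move=> r_gt0 m_gt0; have D0 := nonempty_butterfly r_gt0.
apply/eqP; rewrite eqn_leq; apply/andP; split.
  rewrite -[X in _ <= X](outdeg_word ord0 [ffun=> Ordinal r_gt0]).
  exact: (iffLR (leq_min_outdeg _ D0) (leqnn _)).
apply/leq_min_outdeg => // -[a|[i f]]; rewrite ?outdeg_word // outdeg_hub.
by rewrite -[r in X in X <= _]expn1 leq_pexp2l.
Qed.

(** The words on level [i] that can be reached from the word [f] on level [0]
    without passing a hub: only the letters before [i] have been rewritten. *)
Definition cone (f : word) (i : nat) : {set butterfly} :=
  [set v : butterfly | if v is inr (j, g)
           then (val j == i) && [forall k : 'I_m, (i <= k) ==> (g k == f k)]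
           else false].

Lemma cone_step (f : word) (i : nat) (u v : butterfly) : i < m ->
  u \in cone f i -> arc u v -> v \in cone f i.+1.
Proof.
rewrite !inE => im; case: u => // -[j g] /andP[/eqP ji /forallP gf].
case: v => [b|[j' h]] /=; first by rewrite -val_eqE /= ji ltn_eqF.
rewrite ji => /andP[-> /eq_offP gh] /=; apply/forallP => k; apply/implyP => ik.
by rewrite -gh ?gtn_eqF //; apply: (implyP (gf k)); apply: ltnW.
Qed.

(** The letter [i], which is the only one rewritten on the arc from level [i],
    is still that of [f] in all words of the cone. *)
Lemma cone_injective (f : word) (i : nat) (u u' v : butterfly) : i < m ->
  u \in cone f i -> u' \in cone f i -> arc u v -> arc u' v -> u = u'.
Proof.
rewrite !inE => im; case: u => // -[j g] /andP[/eqP ji /forallP gf].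
case: u' => // -[j' g'] /andP[/eqP j'i /forallP g'f].
case: v => [b|[l h]] /=; first by rewrite -val_eqE /= ji ltn_eqF.
rewrite ji j'i => /andP[_ /eq_offP gh] /andP[_ /eq_offP g'h].
congr (inr (_, _)); first by apply: val_inj; rewrite /= ji j'i.
apply/ffunP => k; case: (eqVneq (val k) i) => [ki|ki]; last by rewrite gh // g'h.
by rewrite (eqP (implyP (gf k) _)) ?(eqP (implyP (g'f k) _)) // ki.
Qed.

(** * Subdigraphs of the butterfly *)

(** A subdigraph is viewed as a digraph [G] with an injective homomorphism
    [phi] to the butterfly, so that its vertices need not be written as
    dependent pairs. *)
Section Subdigraph.

Variables (G : digraph) (phi : G -> butterfly) (t : nat).
Hypothesis phi_inj : injective phi.
Hypothesis phi_arc : forall x y : G, arc x y -> arc (phi x) (phi y).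
Hypothesis tG : forall x : G, t <= outdeg x.

(** Arcs out of a word raise the level until the hubs are reached, and arcs out
    of a hub lead to level [0]. *)
Lemma word_level0_reached : 0 < t -> nonempty G ->
  exists (x : G) (f : word), phi x = inr (ord0, f).
Proof.
move=> t_gt0 /card_gt0P[x0 _].
have succ (x : G) : exists y, arc x y.
  have /card_gt0P[y] : 0 < #|[set y | arc x y]| by apply: leq_trans (tG x).
  by rewrite inE; exists y.
have of_hub (x : G) a : phi x = inl a -> exists y f, phi y = inr (ord0, f).
  move=> xa; have [y /phi_arc] := succ x; rewrite xa /=.
  by case Ey: (phi y) => [//|[j g]] /eqP j0; exists y, g; rewrite Ey j0.
have of_word n : forall (x : G) i f, phi x = inr (i, f) -> m - i = n ->
    exists y f, phi y = inr (ord0, f).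
  elim: n => [|n IHn] x i f xi min; have [y /phi_arc] := succ x; rewrite xi /=;
      case Ey: (phi y) => [b|[j g]]; try by move=> _; apply: of_hub Ey.
    case/andP=> /eqP ji _; have := ltn_ord j; rewrite ji ltnS => im.
    by move/eqP: min; rewrite subn_eq0 leqNgt im.
  by case/andP=> /eqP ji _; apply: IHn Ey _; rewrite ji subnS min.
by case Ex: (phi x0) => [a|[i f]]; [apply: of_hub Ex | apply: of_word Ex erefl].
Qed.

(** By [cone_injective], each level of the cone multiplies the number of its
    vertices that lie in [G] by at least [t]. *)
Lemma cone_growth (x : G) (f : word) (i : nat) : phi x = inr (ord0, f) ->
  i <= m -> t ^ i <= #|phi @^-1: cone f i|.
Proof.
move=> xf; elim: i => [_|i IHi im].
  apply/card_gt0P; exists x; rewrite !inE xf /=.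
  by apply/forallP => k; rewrite eqxx.
rewrite expnS; apply: leq_trans (leq_mul (leqnn t) (IHi (ltnW im))) _.
apply: injective_expansion => // [u v|u u' v]; rewrite ![_ \in phi @^-1: _]inE.
  by move=> uf /phi_arc; apply: cone_step.
move=> uf u'f /phi_arc uv /phi_arc u'v.
by apply: phi_inj; apply: cone_injective uf u'f uv u'v.
Qed.

(** [2 ^ r] bounds the number of sets of hubs, the possible out-neighbourhoods
    of the words on level [m]. *)
Lemma subdigraph_butterfly_contains (s : nat) : 1 < t -> nonempty G ->
  s * 2 ^ r <= m -> contains G (dirK s t).
Proof.
move=> t_gt1 G0 sm; have [x [f xf]] := word_level0_reached (ltnW t_gt1) G0.
pose hubs : {set butterfly} := [set inl a | a in [set: 'I_r]].
have hubs_r : #|phi @^-1: hubs| <= r.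
  rewrite -[X in _ <= X]card_ord -cardsT -(card_imset _ inl_inj).
  rewrite -(card_imset _ phi_inj); apply: subset_leq_card.
  by apply/subsetP => _ /imsetP[y yA ->]; rewrite inE in yA.
apply: (@common_outneighbourhood _ _ _ (phi @^-1: cone f m)
                                       (phi @^-1: hubs)) => //.
  move=> u v; rewrite !inE => uf /phi_arc; case: (phi u) uf => // -[j g].
  case/andP=> /eqP jm _; case: (phi v) => [b _|[l h]]; first exact: imset_f.
  by case/andP=> /eqP lm _; have := ltn_ord l; rewrite lm jm ltnn.
apply: leq_trans (cone_growth xf (leqnn m)).
apply: leq_ltn_trans (ltn_expl m t_gt1); apply: leq_trans sm.
by rewrite leq_mul2l leq_pexp2l ?orbT.
Qed.

End Subdigraph.

End Butterfly.

Lemma exists_eulerian_oriented (s t r : nat) : 0 < s -> 1 < t -> t <= r ->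
  exists D : digraph,
    [/\ nonempty D, eulerian D, oriented D, min_outdeg D = r
      & forall H : subdigraph D,
          nonempty H -> t <= min_outdeg H -> contains H (dirK s t)].
Proof.
move=> s_gt0 t_gt1 tr; have r_gt0 : 0 < r by apply: leq_trans tr; apply: ltnW.
have m_gt0 : 0 < s * 2 ^ r by rewrite muln_gt0 s_gt0 expn_gt0.
exists (butterfly r (s * 2 ^ r)); split.
- exact: nonempty_butterfly.
- exact: eulerian_butterfly.
- exact: oriented_butterfly.
- exact: min_outdeg_butterfly.
move=> H H0 /(leq_min_outdeg _ H0) tH.
apply: (@subdigraph_butterfly_contains _ _ H val) => //; first exact: val_inj.
by move=> u v /= /subarcP[].
Qed.

Theorem theorem1p3 (s t : nat) (s_gt0 : 0 < s) (t_gt0 : 0 < t) :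
  ~ eulerian_avoidable (dirK s t) /\
  (2 <= s -> 2 <= t -> forall r : nat, t <= r ->
    exists D : digraph,
      [/\ nonempty D, eulerian D, oriented D, min_outdeg D = r
        & forall H : subdigraph D,
            nonempty H -> t <= min_outdeg H -> contains H (dirK s t)]).
Proof.
split=> [avoidable|_ t_gt1 r tr]; last exact: exists_eulerian_oriented.
have [|d dP] := avoidable (maxn t 2); first by rewrite leq_max orbT.
have t2_gt1 : 1 < maxn t 2 by rewrite leq_max orbT.
have [D [D0 D_eul _ D_r D_K]] :=
  exists_eulerian_oriented s_gt0 t2_gt1 (leq_maxr d (maxn t 2)).
have [|H [H0 H_free H_t]] := dP D D0 D_eul; first by rewrite D_r leq_maxl.
apply: H_free; apply: contains_dirK_monotone (leq_maxl t 2) _.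
exact: D_K.
Qed.
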